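(* Let $d\ge1$ and $k\ge 2$ be integers, and let $\vec w^1,\ldots,\vec w^k\in\mathbb N^d$ satisfy $\gcd(w^1_i,\ldots,w^k_i)=1$ for all $i=1,\ldots,d$. Let $Y=Y(\vec w^1,\ldots,\vec w^k)$ be the $\vec w^1,\ldots,\vec w^k$ domino tiling shift, and let $y^P\in Y$ be the good brick wall with domino $\tau^P$. Then the set $$Z=\bigcup_{\vec v\in\mathbb Z^d}\{T^{\vec v}(y^P)\},$$ where $T$ denotes the shift action of $\mathbb Z^d$ on $Y$, is a uniform filling set for $Y$.
   Context: $\mathbb N=\{1,2,\ldots\}$. For $\vec w\in\mathbb N^d$, $R_{\vec w}=\prod_{i=1}^d\{0,1,\ldots,w_i-1\}\subset\mathbb Z^d$, and for an integer $\ell>0$, $R^\ell_{\vec w}=\{\vec v\in\mathbb Z^d:-\ell\le v_i\le w_i-1+\ell,\ 1\le i\le d\}$. Superscript $c$ denotes complement in $\mathbb Z^d$, and $|\cdot|$ denotes cardinality. Domino tiling shift: given $\vec w^1,\ldots,\vec w^k\in\mathbb N^d$, let $\vec W\in\mathbb N^d$ be given by $W_i=\prod_{j=1}^k w^j_i$. There are $k+1$ domino types: $\tau^1,\ldots,\tau^k$, where $\tau^j$ has shape $R_{\vec w^j}$, and the large domino $\tau^P$, of shape $R_{\vec W}$ (distinct as labels even if shapes coincide). The alphabet is $\mathcal A=\{\tau^j_{\vec v}:1\le j\le k,\ \vec v\in R_{\vec w^j}\}\cup\{\tau^P_{\vec v}:\vec v\in R_{\vec W}\}$. The domino tiling shift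 $Y=Y(\vec w^1,\ldots,\vec w^k)\subset\mathcal A^{\mathbb Z^d}$ is the shift of finite type coding all tilings of $\mathbb Z^d$ by translates of these dominos: $y\in Y$ iff for every $\vec n\in\mathbb Z^d$, writing $y[\vec n]=\tau^a_{\vec v}$ with $a\in\{1,\ldots,k,P\}$ and $R$ the shape of $\tau^a$, one has $y[\vec n-\vec v+\vec u]=\tau^a_{\vec u}$ for all $\vec u\in R$. The shift action is $(T^{\vec v}y)[\vec n]=y[\vec n+\vec v]$. For $S\subset\mathbb Z^d$, $y[S]$ denotes the restriction of $y$ to $S$. Good brick wall: the good brick wall with domino $\tau^P$ is the periodic point $y^P\in Y$ with $y^P[\vec v]=\tau^P_{(v_1\bmod W_1,\ldots,v_d\bmod W_d)}$ for all $\vec v\in\mathbb Z^d$. Uniform filling set: a subset $Z\subset Y$ of a shift of finite type $Y$ is a uniform filling set for $Y$ if $Z$ is invariant under all shifts, $|Z|>1$, and there is an integer $\ell>0$ (the filling length) such that for every $\vec w\in\mathbb N^d$ and all $z,z'\in Z$ there is a point $y\in Y$ with $y[R_{\vec w}]=z[R_{\vec w}]$ and $y[(R^\ell_{\vec w})^c]=z'[(R^\ell_{\vec w})^c]$.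
   Formalization: The formal theorem assumes that some $w^j_i\neq 1$; if all $\vec w^j=(1,\ldots,1)$, then $y^P$ is constant, $Z=\{y^P\}$ and $|Z|=1$, so $Z$ is not a uniform filling set. *)

(* Defs.v *)
From HB Require Import structures.
From mathcomp Require Import all_boot all_order all_algebra.
From mathcomp Require Import boolp classical_sets functions cardinality.

Set Implicit Arguments.
Unset Strict Implicit.
Unset Printing Implicit Defensive.

Import Order.TTheory GRing.Theory Num.Theory.
Local Open Scope classical_set_scope.
Local Open Scope ring_scope.

Notation lattice d := {ffun 'I_d -> int}.

Section Rectangles.
Context (d : nat).
Implicit Types (w : 'I_d -> nat) (l : int).

Definition rect w : pred (lattice d) :=
  fun v => [forall i, 0 <= v i <= (w i)%:Z - 1].

Definition rect_ext l w : pred (lattice d) :=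
  fun v => [forall i, - l <= v i <= (w i)%:Z - 1 + l].

End Rectangles.

Section Shifts.
Context (d : nat) (A : Type).
Implicit Types (y z : lattice d -> A) (Y Z : set (lattice d -> A)).

Definition shift (v : lattice d) y : lattice d -> A := fun n => y (n + v).

(* The cardinality clause is |Z| >= 2; [`I_2] is the set {0, 1}. *)
Definition uniform_filling_set Y Z : Prop :=
  [/\ Z `<=` Y,
      forall v, shift v @` Z = Z,
      (`I_2 #<= Z)%card
    & exists2 l : int, 0 < l &
      forall w : 'I_d -> nat, (forall i, (0 < w i)%N) ->
      forall z z', Z z -> Z z' ->
      exists2 y, Y y &
        {in rect w, y =1 z} /\ {in predC (rect_ext l w), y =1 z'}].

End Shifts.

Section Dominos.
Context (d k : nat) (w : 'I_k -> 'I_d -> nat).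

Definition large_dims (i : 'I_d) : nat := (\prod_(j < k) w j i)%N.

(* [Some j] labels the domino tau^j and [None] the large domino tau^P. *)
Definition domino_dims (a : option 'I_k) : 'I_d -> nat :=
  if a is Some j then w j else large_dims.

(* [Letter a v _] is the symbol tau^a_v. *)
Record letter : Type := Letter {
  label : option 'I_k;
  offset : lattice d;
  offset_in : offset \in rect (domino_dims label) }.

Definition domino_shift : set (lattice d -> letter) :=
  [set y | forall (n u : lattice d)
                  (hu : u \in rect (domino_dims (label (y n)))),
             y (n - offset (y n) + u) = Letter hu].

Hypothesis w_gt0 : forall j i, (0 < w j i)%N.

Definition modW (v : lattice d) : lattice d :=
  [ffun i => (v i %% (large_dims i)%:Z)%Z].

Lemma modW_in v : modW v \in rect (domino_dims None).
Proof.
apply/forallP => i; rewrite ffunE.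
have W_gt0 : (0 < large_dims i)%N by apply: prodn_gt0.
by rewrite modz_ge0 -?lt0n //= lerBrDr -ltzD1 ltrD2r ltz_pmod.
Qed.

Definition good_brick_wall : lattice d -> letter :=
  fun v => Letter (modW_in v).

End Dominos.

Arguments domino_shift {d k} w _.

(* Main.v *)
(* Both points are bricks of [tau^P] on translated grids. Keep the first one on
   a box [B] of its own grid covering the window, the second one outside a
   larger box [B'] of its grid, and peel [B' \ B] one coordinate at a time:
   each piece is a box whose sides are multiples of the [W_t], except for one
   side, which can be prescribed to be longer than any given bound. As
   [gcd_j w^j_i = 1], a long enough side is a sum of numbers [w^j_i], which
   slices the piece into boxes whose sides are multiples of those of a single
   [tau^j]. *)
Require Import Defs.
From HB Require Import structures.
From mathcomp Require Import all_boot all_order all_algebra.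
From mathcomp Require Import boolp classical_sets functions cardinality.
From mathcomp Require Import zify.

Set Implicit Arguments.
Unset Strict Implicit.
Unset Printing Implicit Defensive.

Import Order.TTheory GRing.Theory Num.Theory.
Local Open Scope classical_set_scope.
Local Open Scope ring_scope.

(** * Semigroup and residue arithmetic *)

(* Since [P] may be any predicate closed under the additions [n |-> n + f i],
   this says that the semigroup generated by the [f i] contains all large
   multiples of their gcd. *)
Lemma gcd_numerical_semigroup (I : Type) (r : seq I) (f : I -> nat)
    (P : nat -> Prop) :
    P 0%N -> (forall i n, P n -> P (n + f i)%N) ->
  exists N, forall n, (N <= n)%N -> (\big[gcdn/0]_(i <- r) f i %| n)%N -> P n.
Proof.
move=> P0 PD.
have PM i q n : P n -> P (n + q * f i)%N.
  by move=> Pn; elim: q => [|q IH]; rewrite ?addn0 // mulSnr addnA; apply: PD.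
elim: r => [|i r [N PN]].
  by exists 0%N => n _; rewrite big_nil dvd0n => /eqP ->.
rewrite big_cons; set g := \big[gcdn/0%N]_(j <- r) f j in PN *.
have [->|g_gt0] := posnP g.
  by exists 0%N => n _; rewrite gcdn0 => /dvdnP[q ->]; apply: (PM i q 0%N).
(* The extra [g * f i] keeps [n - m * f i] at least [N] for the [m] chosen below. *)
exists (N + g * f i)%N => n Nn /dvdnP[q def_n].
have [fi0|fi_gt0] := posnP (f i).
  apply: PN; first by move: Nn; rewrite fi0; lia.
  by rewrite def_n fi0 gcd0n dvdn_mull.
have [a b def_gcd _] := egcdnP g fi_gt0.
(* Bezout: subtracting [m * f i] from [n], with [m < g], leaves a multiple
   of [g]. *)
pose m := ((q * a) %% g)%N.
have m_lt : (m < g)%N by rewrite ltn_mod.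
have mf : (m * f i <= g * f i)%N by rewrite leq_mul2r ltnW ?orbT.
have -> : n = (n - m * f i + m * f i)%N by lia.
apply: PM; apply: PN; first by lia.
have mn : (m * f i <= n)%N by lia.
(* Modulo [g], [m * f i] is congruent to [q * a * f i = q * b * g + n], hence to [n]. *)
rewrite -(eqn_mod_dvd _ mn) modnMml -mulnA def_gcd mulnDr -def_n.
by rewrite mulnA modnMDl.
Qed.

(** [x - ((x - c) %% s)] is the lower end of the cell of [x] in the grid of mesh [s] through [c], so
    adding [u] stays in that cell, at residue [u]. *)
Lemma modz_cell (s x c u : int) : 0 <= u < s ->
  (x - ((x - c) %% s)%Z + u - c = u %[mod s])%Z /\
  ((x - ((x - c) %% s)%Z + u - c) %/ s)%Z = ((x - c) %/ s)%Z.
Proof.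
move=> us; have s_neq0 : s != 0 by lia.
have -> : x - ((x - c) %% s)%Z + u - c = ((x - c) %/ s)%Z * s + u.
  by have := divz_eq (x - c) s; lia.
by rewrite modzMDl divzMDl // (divz_small (m := u)) ?addr0 //; lia.
Qed.

Lemma multiple_below (s x v : int) : 0 < s ->
  exists2 y, x - s < y <= x & (s %| y + v)%Z.
Proof.
move=> s_gt0; exists (x - ((x + v) %% s)%Z).
  have := modz_ge0 (x + v) (lt0r_neq0 s_gt0).
  by have := ltz_pmod (x + v) s_gt0; lia.
by apply/dvdzP; exists ((x + v) %/ s)%Z; have := divz_eq (x + v) s; lia.
Qed.

(** * Tilings of subsets and their gluing *)

Section PartialTilings.
Context (d k : nat) (w : 'I_k -> 'I_d -> nat).
Hypothesis w_gt0 : forall j i, (0 < w j i)%N.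
Hypothesis w_gcd : forall i : 'I_d, \big[gcdn/0%N]_(j < k) w j i = 1%N.
Implicit Types (D : set (lattice d)) (y : lattice d -> letter w).
Implicit Types (a : option 'I_k) (c lo hi : 'I_d -> int).

Lemma letter_eq (x y : letter w) :
  label x = label y -> offset x = offset y -> x = y.
Proof.
case: x y => [a u hu] [b v hv] /= eq_ab eq_uv.
by subst b v; congr Letter; apply: bool_irrelevance.
Qed.

(** Besides the local rule of [domino_shift], dominos met in [D] must stay in [D]. Values of [y] off
    [D] then do not matter, and tilings of disjoint sets glue without any matching condition. *)
Definition tiles D y := forall n, D n ->
  forall u (hu : u \in rect (domino_dims w (label (y n)))),
  D (n - offset (y n) + u) /\ y (n - offset (y n) + u) = Letter hu.

Lemma tilesT y : tiles setT y -> domino_shift w y.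
Proof. by move=> Ty n u hu; case: (Ty n I u hu). Qed.

Definition glue D y1 y2 : lattice d -> letter w :=
  fun n => if `[< D n >] then y1 n else y2 n.

Lemma tiles_glue D1 D2 y1 y2 : D1 `&` D2 = set0 ->
  tiles D1 y1 -> tiles D2 y2 -> tiles (D1 `|` D2) (glue D1 y1 y2).
Proof.
move=> D12 T1 T2 n Dn u.
have out m : D2 m -> ~ D1 m.
  by move=> D2m D1m; suff: set0 m by []; rewrite -D12.
have [D1n|nD1n] := pselect (D1 n).
  have -> : glue D1 y1 y2 n = y1 n by rewrite /glue asboolT.
  move=> hu; have [D1n' <-] := T1 n D1n u hu.
  by split; [left | rewrite /glue asboolT].
have D2n : D2 n by case: Dn.
have -> : glue D1 y1 y2 n = y2 n by rewrite /glue asboolF.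
move=> hu; have [D2n' <-] := T2 n D2n u hu.
by split; [right | rewrite /glue asboolF //; apply: out].
Qed.

Definition tileable D := exists y, tiles D y.

Lemma tileableU D1 D2 : D1 `&` D2 = set0 ->
  tileable D1 -> tileable D2 -> tileable (D1 `|` D2).
Proof. by move=> D12 [y1 T1] [y2 T2]; eexists; apply: tiles_glue D12 T1 T2. Qed.

Lemma tileable0 : tileable set0.
Proof. by exists (good_brick_wall w_gt0). Qed.

(** * Translated grids of a single domino *)

Lemma domino_dims_gt0 a i : (0 < domino_dims w a i)%N.
Proof. by case: a => [j|] //=; apply: prodn_gt0. Qed.

Definition brick_offset a c (n : lattice d) : lattice d :=
  [ffun i => ((n i - c i) %% (domino_dims w a i)%:Z)%Z].

Lemma brick_offset_in a c n : brick_offset a c n \in rect (domino_dims w a).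
Proof.
apply/forallP => i; rewrite ffunE.
have s_gt0 := domino_dims_gt0 a i.
rewrite modz_ge0 -?lt0n //= lerBrDr -ltzD1 ltrD2r ltz_pmod //.
Qed.

Definition brick a c : lattice d -> letter w :=
  fun n => Letter (brick_offset_in a c n).

(** The hypothesis makes [D] a union of cells of the grid, so the domino through a point of [D]
    stays in [D]. *)
Lemma tiles_brick a c D :
    (forall n n' : lattice d,
       (forall i, ((n' i - c i) %/ (domino_dims w a i)%:Z)%Z
                  = ((n i - c i) %/ (domino_dims w a i)%:Z)%Z) ->
       D n -> D n') ->
  tiles D (brick a c).
Proof.
move=> D_sat n Dn u /= hu.
have cell i := @modz_cell (domino_dims w a i)%:Z (n i) (c i) (u i).
have u_lt i : 0 <= u i < (domino_dims w a i)%:Z.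
  by move/forallP/(_ i): hu; lia.
split.
  by apply: D_sat Dn => i; rewrite !ffunE; case: (cell i (u_lt i)).
apply: letter_eq => //=; apply/ffunP => i; rewrite !ffunE.
by case: (cell i (u_lt i)) => -> _; rewrite modz_small.
Qed.

(** * Boxes, slabs and shells *)

Definition box lo hi : set (lattice d) := [set n | forall i, lo i <= n i < hi i].

Lemma box_sat a lo hi :
    (forall i, ((domino_dims w a i)%:Z %| hi i - lo i)%Z) ->
  forall n n' : lattice d,
    (forall i, ((n' i - lo i) %/ (domino_dims w a i)%:Z)%Z
               = ((n i - lo i) %/ (domino_dims w a i)%:Z)%Z) ->
  box lo hi n -> box lo hi n'.
Proof.
move=> dvd n n' eq_q Bn i; have /andP[lo_n n_hi] := Bn i.
have s_gt0 : 0 < (domino_dims w a i)%:Z by rewrite ltz_nat domino_dims_gt0.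
have /dvdzP[q def_hi] := dvd i.
(* Both bounds can be read off the cell index: the lower one says that it is nonnegative, the upper
   one that it is less than [q]. *)
rewrite -subr_ge0 -(divz_ge0 _ s_gt0) eq_q divz_ge0 // subr_ge0 lo_n /=.
rewrite -(ltrD2r (- lo i)) def_hi -ltz_divLR // eq_q ltz_divLR // -def_hi.
by rewrite ltrD2r.
Qed.

Lemma tileable_box_brick a lo hi :
    (forall i, ((domino_dims w a i)%:Z %| hi i - lo i)%Z) ->
  tileable (box lo hi).
Proof. by move=> dvd; exists (brick a lo); apply/tiles_brick/box_sat. Qed.

Definition upd c i x : 'I_d -> int := fun t => if t == i then x else c t.

Lemma box_cut lo hi i x : lo i <= x <= hi i ->
  box lo hi = box lo (upd hi i x) `|` box (upd lo i x) hi.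
Proof.
move=> x_in; apply/seteqP; split=> n.
  move=> Bn; have [n_x|x_n] := ltP (n i) x; [left|right] => t; move: (Bn t);
    by rewrite /upd; case: eqP => [->|//]; lia.
by case=> Bn t; move: (Bn t); rewrite /upd; case: eqP => [->|//]; lia.
Qed.

(** Coordinate [i] alone separates the boxes. The other bounds are left unrelated so that the lemma
    also applies to boxes cut a second time. *)
Lemma box_cut_disjoint lo hi lo' hi' i x :
  box lo (upd hi i x) `&` box (upd lo' i x) hi' = set0.
Proof.
apply/seteqP; split=> // n [/(_ i) + /(_ i)].
by rewrite /upd eqxx; lia.
Qed.

Lemma tileable_slab i : exists N : nat, forall lo hi,
    lo i + N%:Z <= hi i ->
    (forall t, t != i -> ((large_dims w t)%:Z %| hi t - lo t)%Z) ->
  tileable (box lo hi).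
Proof.
(* Quantifying over all boxes inside [P] lets the induction pass to shorter boxes and makes [P]
   closed under adding [w j i]. *)
pose P n := forall lo hi, hi i = lo i + n%:Z ->
  (forall t, t != i -> ((large_dims w t)%:Z %| hi t - lo t)%Z) ->
  tileable (box lo hi).
have P0 : P 0%N.
  move=> lo hi hi_i _; suff -> : box lo hi = set0 by apply: tileable0.
  by apply/seteqP; split=> // n /(_ i); lia.
have PD j n : P n -> P (n + w j i)%N.
  move=> Pn lo hi hi_i dvd; have x_in : lo i <= lo i + n%:Z <= hi i by lia.
  rewrite (box_cut x_in); apply: tileableU (box_cut_disjoint _ _ _ _ _ _) _ _.
    by apply: Pn => [|t ti]; rewrite /upd ?eqxx // (negPf ti); apply: dvd.
  (* The added layer is exactly [w j i] thick, and its other sides are multiples of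
     [large_dims w t], hence of [w j t]. *)
  apply: (tileable_box_brick (a := Some j)) => t /=; rewrite /upd.
  case: eqVneq => [->|ti]; first by apply/dvdzP; exists 1; lia.
  apply: dvdz_trans (dvd t ti); rewrite dvdzE /= /large_dims.
  by rewrite (bigD1 j) //= dvdn_mulr.
have [N PN] := gcd_numerical_semigroup (index_enum 'I_k) P0 PD.
exists N => lo hi N_le; have [n def_n] : exists n, hi i - lo i = Posz n.
  by exists (absz (hi i - lo i)); lia.
by apply: (PN n); [lia | rewrite w_gcd dvd1n | lia].
Qed.

Lemma tileable_shell : exists N : nat, forall lo hi lo' hi',
    (forall i, [/\ lo' i + N%:Z <= lo i, lo i <= hi i & hi i + N%:Z <= hi' i]) ->
    (forall i, ((large_dims w i)%:Z %| hi i - lo i)%Z) ->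
    (forall i, ((large_dims w i)%:Z %| hi' i - lo' i)%Z) ->
  tileable (box lo' hi' `\` box lo hi).
Proof.
have [M slab] := choice tileable_slab.
(* The sum dominates every [M i], giving one margin for all directions. *)
exists (\sum_i M i)%N => lo hi lo' hi' sep dvd dvd'.
have {}sep i : [/\ lo' i + (M i)%:Z <= lo i, lo i <= hi i
                & hi i + (M i)%:Z <= hi' i].
  have := sep i; rewrite (bigD1 i) //=.
  by move: (\sum_(_ < d | _) _)%N => m [? ? ?]; split; lia.
(* Inner bounds in the first [m] coordinates, outer bounds elsewhere: the box shrinks from the outer
   one at [m = 0] to the inner one at [m = d]. *)
pose mix m c c' : 'I_d -> int := fun i => if (i < m)%N then c i else c' i.
suff T m : (m <= d)%N ->
    tileable (box lo' hi' `\` box (mix m lo lo') (mix m hi hi')).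
  have mixd c c' : mix d c c' = c by apply/funext => i; rewrite /mix ltn_ord.
  by have := T d (leqnn d); rewrite !mixd.
elim: m => [_|m IH m_lt]; first by rewrite setDv; apply: tileable0.
pose i : 'I_d := Ordinal m_lt.
have mixS c c' : mix m.+1 c c' = upd (mix m c c') i (c i).
  apply/funext => t; rewrite /mix /upd ltnS leq_eqVlt -(inj_eq val_inj) /=.
  by case: eqP => [ti|//]; congr c; apply: val_inj.
have [lo_le lo_hi le_hi] := sep i.
set L := mix m lo lo'; set H := mix m hi hi'.
have Li : L i = lo' i by rewrite /L /mix ltnn.
have Hi : H i = hi' i by rewrite /H /mix ltnn.
(* Shrinking direction [i] removes one slab on each side; the nested [upd] in [S2] is the form left
   by cutting twice. *)
pose S1 := box L (upd H i (lo i)).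
pose S2 := box (upd (upd L i (lo i)) i (hi i)) H.
have cut : box L H = S1 `|` (box (mix m.+1 lo lo') (mix m.+1 hi hi') `|` S2).
  rewrite (@box_cut L H i (lo i)) ?Li ?Hi; last by lia.
  rewrite (@box_cut (upd L i _) H i (hi i)) -?mixS //.
    by rewrite (mixS lo lo').
  by rewrite mixS /upd eqxx Hi; lia.
have dvd_mix t : ((large_dims w t)%:Z %| H t - L t)%Z.
  by rewrite /H /L /mix; case: ifP.
(* Along [i] this slab has length [lo i - lo' i], which is at least [M i]; its other sides are
   covered by [dvd_mix]. *)
have T1 : tileable S1.
  apply: (slab i) => [|t ti]; rewrite /upd ?eqxx ?Li ?Hi //.
  by rewrite (negPf ti).
have T2 : tileable S2.
  apply: (slab i) => [|t ti]; rewrite /upd ?eqxx ?Li ?Hi //.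
  by rewrite (negPf ti).
have S12 : S1 `&` S2 = set0.
  apply/seteqP; split=> // n [/(_ i) + /(_ i)].
  by rewrite /upd !eqxx; lia.
have S1C : S1 `&` box (mix m.+1 lo lo') (mix m.+1 hi hi') = set0.
  by rewrite !mixS; apply: box_cut_disjoint.
have CS2 : box (mix m.+1 lo lo') (mix m.+1 hi hi') `&` S2 = set0.
  by rewrite !mixS; apply: box_cut_disjoint.
have sub : box L H `<=` box lo' hi'.
  move=> n Bn t; move: (Bn t) (sep t); rewrite /L /H /mix.
  by case: ifP => // _ + []; lia.
have -> : box lo' hi' `\` box (mix m.+1 lo lo') (mix m.+1 hi hi')
        = (box lo' hi' `\` box L H) `|` (S1 `|` S2).
  move: sub cut S1C CS2; set C := box (mix _ _ _) _; set B := box lo' hi'.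
  move: (box L H) => BLH sub cut S1C CS2; apply/seteqP; split=> n.
    move=> [Bn nCn]; have [|nB] := pselect (BLH n); last by left.
    by rewrite cut => -[|[]] ?; right; [left|done|right].
  have no (D1 D2 : set (lattice d)) : D1 `&` D2 = set0 -> D1 n -> ~ D2 n.
    by move=> D12 D1n D2n; suff: set0 n by []; rewrite -D12.
  case=> [[Bn nB]|Sn].
    by split=> // Cn; apply: nB; rewrite cut; right; left.
  split; first by apply: sub; rewrite cut; case: Sn; [left | right; right].
  by case: Sn => [/(no _ _ S1C)|S2n /(no _ _ CS2)].
apply: tileableU; [|exact/IH/ltnW|exact: tileableU].
apply/seteqP; split=> // n [[_ nB] Sn]; apply: nB; rewrite cut.
by case: Sn; [left | right; right].
Qed.

(** * Interpolation between two brick walls *)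

Lemma fill_point : exists N : nat, forall lo hi lo' hi',
    (forall i, [/\ lo' i + N%:Z <= lo i, lo i <= hi i & hi i + N%:Z <= hi' i]) ->
    (forall i, ((large_dims w i)%:Z %| hi i - lo i)%Z) ->
    (forall i, ((large_dims w i)%:Z %| hi' i - lo' i)%Z) ->
  exists2 y, domino_shift w y &
    (forall n, box lo hi n -> y n = brick None lo n) /\
    (forall n, ~ box lo' hi' n -> y n = brick None lo' n).
Proof.
have [N shell] := tileable_shell.
exists N => lo hi lo' hi' sep dvd dvd'.
have [ysh Tsh] := shell _ _ _ _ sep dvd dvd'.
set B := box lo hi in Tsh *; set B' := box lo' hi' in Tsh *.
have sub : B `<=` B'.
  by move=> n Bn i; move: (Bn i); case: (sep i); lia.
have Tin : tiles B (brick None lo) by apply/tiles_brick/box_sat.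
(* The complement of a union of cells is again a union of cells. *)
have Tout : tiles (~` B') (brick None lo').
  apply: tiles_brick => n n' eq_q nB' B'n'; apply: nB'.
  exact: (box_sat (a := None) dvd' (fun i => esym (eq_q i)) B'n').
have disj1 : (B' `\` B) `&` ~` B' = set0.
  by apply/seteqP; split=> // n [[]].
have disj2 : B `&` ((B' `\` B) `|` ~` B') = set0.
  by apply/seteqP; split=> // n [Bn] [[]|/(_ (sub n Bn))].
exists (glue B (brick None lo) (glue (B' `\` B) ysh (brick None lo'))).
  apply: tilesT; suff <- : B `|` ((B' `\` B) `|` ~` B') = setT.
    exact: tiles_glue disj2 Tin (tiles_glue disj1 Tsh Tout).
  apply/seteqP; split=> // n _.
  have [Bn|nBn] := pselect (B n); first by left.
  by right; have [B'n|nB'n] := pselect (B' n); [left|right].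
split=> n; first by move=> Bn; rewrite /glue asboolT.
move=> nB'n; rewrite /glue !asboolF //; first by case.
by move=> /sub.
Qed.

(** Any [c] congruent to [- v] modulo the large dimensions is a corner of the shifted grid, so the
    corner of a suitable box can serve as its origin. *)
Lemma shift_good_brick_wall (v : lattice d) c n :
    (forall i, ((large_dims w i)%:Z %| c i + v i)%Z) ->
  shift v (good_brick_wall w_gt0) n = brick None c n.
Proof.
move=> dvd; apply: letter_eq => //=; apply/ffunP => i; rewrite !ffunE.
apply/eqP; rewrite eqz_mod_dvd.
by have -> : n i + v i - (n i - c i) = c i + v i by lia.
Qed.

Lemma good_brick_wall_shift_in v :
  domino_shift w (shift v (good_brick_wall w_gt0)).
Proof.
have -> : shift v (good_brick_wall w_gt0) = brick None (fun i => - v i).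
  apply/funext => n; apply: shift_good_brick_wall => i.
  by rewrite addNr dvdz0.
by apply/tilesT/tiles_brick.
Qed.

End PartialTilings.

(** * Cardinality of the orbit and the filling length *)

Lemma card_ge2 (T : Type) (A : set T) x y : A x -> A y -> x <> y ->
  (`I_2 #<= A)%card.
Proof.
move=> Ax Ay xy; apply/card_subP; exists [set x; y]; last by move=> _ [->|->].
apply/eq_cardSP; exists x; first by left.
suff -> : [set x; y] `\ x = [set y] by apply: card_set1.
apply/seteqP; split=> z; first by case=> -[].
by move=> ->; split; [right | move/esym].
Qed.

Theorem theorem3p3 (d k : nat) (w : 'I_k -> 'I_d -> nat)
    (d_ge1 : (1 <= d)%N) (k_ge2 : (2 <= k)%N)
    (w_gt0 : forall j i, (0 < w j i)%N)
    (w_gcd : forall i : 'I_d, \big[gcdn/0%N]_(j < k) w j i = 1%N)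
    (w_nontriv : exists j i, w j i != 1%N) :
  uniform_filling_set (domino_shift w)
    (\bigcup_(v in [set: lattice d]) [set shift v (good_brick_wall w_gt0)]).
Proof.
set yP := good_brick_wall w_gt0.
have shiftD u v : shift v (shift u yP) = shift (v + u) yP.
  by apply/funext => n; rewrite /shift addrA.
split.
- by move=> _ [v _ ->]; apply: good_brick_wall_shift_in.
- move=> v; apply/seteqP; split=> z.
    by move=> [_ [u _ ->] <-]; exists (v + u); rewrite //= shiftD.
  move=> [u _ ->]; exists (shift (u - v) yP); first by exists (u - v).
  by rewrite shiftD addrC subrK.
(* With all dimensions 1 the orbit would be a single point. Here [large_dims w i > 1], so shifting
   by the all-ones vector changes coordinate [i] of the offset at the origin from 0 to 1. *)
- have [j [i wji]] := w_nontriv.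
  pose e : lattice d := [ffun=> 1].
  apply: (@card_ge2 _ _ (shift 0 yP) (shift e yP)); [by exists 0|by exists e|].
  move/(congr1 (fun y => offset (y 0) i)); rewrite /= !ffunE.
  have W_gt1 : (1 < large_dims w i)%N.
    rewrite /large_dims (bigD1 j) //=; set m := (\prod_(_ < _ | _) _)%N.
    have m_gt0 : (0 < m)%N by apply: prodn_cond_gt0.
    by have := w_gt0 j i; nia.
  by rewrite !modz_small //; lia.
have [N fill] := fill_point w_gt0 w_gcd.
pose W i := (large_dims w i)%:Z.
have W_gt0 i : 0 < W i by rewrite ltz_nat; apply: prodn_gt0.
pose S := (\sum_i large_dims w i)%N.
have W_le i : W i <= S%:Z by rewrite lez_nat /S (bigD1 i) //= leq_addr.
(* On each side, rounding to the first grid and then to the second costs less than [W i <= S] each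
   time, and the shell needs a margin [N]; the [+ 1] makes positivity immediate. *)
exists (N%:Z + 2 * S%:Z + 1); first by lia.
move=> r r_gt0 _ _ [v _ ->] [v' _ ->].
have corner x (u : lattice d) : exists y : 'I_d -> int,
    forall i, x i - W i < y i <= x i /\ (W i %| y i + u i)%Z.
  have /choice[y y_in] i : exists z, x i - W i < z <= x i /\ (W i %| z + u i)%Z.
    by have [z] := multiple_below (x i) (u i) (W_gt0 i); exists z.
  by exists y.
have dvdB (u : lattice d) (y y' : 'I_d -> int) :
    (forall i, (W i %| y i + u i)%Z) -> (forall i, (W i %| y' i + u i)%Z) ->
  forall i, (W i %| y' i - y i)%Z.
  move=> dy dy' i; have -> : y' i - y i = y' i + u i - (y i + u i) by lia.
  exact: rpredB.
have [lo /all_and2[lo_in lo_dvd]] := corner (fun=> 0) v.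
(* Rounding [r i + W i - 1] down to the grid amounts to rounding [r i] up, so the box covers the
   window. *)
have [hi /all_and2[hi_in hi_dvd]] := corner (fun i => (r i)%:Z + W i - 1) v.
have [lo' /all_and2[lo'_in lo'_dvd]] := corner (fun i => lo i - N%:Z) v'.
have [hi' /all_and2[hi'_in hi'_dvd]] :=
  corner (fun i => hi i + N%:Z + W i - 1) v'.
have [|||y Yy [y_in y_out]] := fill lo hi lo' hi'.
- move=> i; move: (lo_in i) (hi_in i) (lo'_in i) (hi'_in i) (W_gt0 i).
  by split; lia.
- exact: dvdB lo_dvd hi_dvd.
- exact: dvdB lo'_dvd hi'_dvd.
exists y => //; split=> n.
  move=> /forallP r_n; rewrite (shift_good_brick_wall w_gt0 n lo_dvd).
  apply: y_in => i; move: (r_n i) (lo_in i) (hi_in i); lia.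
rewrite !inE => nR; rewrite (shift_good_brick_wall w_gt0 n lo'_dvd).
(* By contraposition, it suffices that the larger box lies in the extended window. *)
apply: y_out => Bn; case/negP: nR; apply/forallP => i.
move: (Bn i) (lo_in i) (hi_in i) (lo'_in i) (hi'_in i) (W_le i); lia.
Qed.
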